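(* Let $A$ be a Noetherian integral domain. Suppose that $A$ satisfies Serre's condition $(S_2)$ and that $A$ contains an infinite field. Then $A$ is a weakly Arf ring if and only if the polynomial ring $A[X_1, X_2, \ldots, X_n]$ is a weakly Arf ring for every $n \ge 1$.
   Context: For a commutative ring $A$, $Q(A)$ denotes its total ring of fractions and $\overline{A}$ the integral closure of $A$ in $Q(A)$. A commutative ring $A$ is called weakly Arf if $yz/x \in A$ whenever $x,y,z\in A$ are such that $x$ is a non-zerodivisor on $A$ and $y/x, z/x \in Q(A)$ are integral over $A$. A Noetherian ring $A$ satisfies $(S_n)$ if $\operatorname{depth} A_P \ge \min\{n, \dim A_P\}$ for all $P \in \operatorname{Spec} A$. *)

(* Defs.v *)
From HB Require Import structures.
From mathcomp Require Import all_boot all_order all_algebra.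
From mathcomp Require Import boolp classical_sets cardinality.
From mathcomp Require Import mpoly.

Set Implicit Arguments.
Unset Strict Implicit.
Unset Printing Implicit Defensive.

Import GRing.Theory.
Local Open Scope ring_scope.

Notation "x %:F" := (tofrac x) : ring_scope.

(* [idealr] and [prime_idealr] are boolean predicates; as [asbool] turns every
   proposition into a boolean, they range over all ideals, not only over the
   constructively decidable ones. *)

(* Natural numbers with a top element [None]. *)
Definition natinf := option nat.

Definition natinf_le (a b : natinf) : bool :=
  match a, b with
  | _, None => true
  | None, Some _ => false
  | Some m, Some n => (m <= n)%N
  end.

Definition natinf_min (a b : natinf) : natinf := if natinf_le a b then a else b.

Definition nat_ubound (S : nat -> Prop) (m : nat) : bool :=
  `[< forall k, S k -> (k <= m)%N >].

(* The supremum of [S]; it is 0 when [S] is empty. *)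
Definition natinf_sup (S : nat -> Prop) : natinf :=
  match pselect (exists m, nat_ubound S m) with
  | left bounded => Some (ex_minn bounded)
  | right _ => None
  end.

Definition ideal_gen (R : comNzRingType) (s : seq R) (x : R) : Prop :=
  exists c : nat -> R, x = \sum_(i < size s) c i * s`_i.

(* [idealr] only contains proper ideals; the unit ideal is generated by 1. *)
Definition noetherian (R : comNzRingType) : Prop :=
  forall I : idealr R, exists s : seq R, forall x, x \in I <-> ideal_gen s x.

Definition prime_lt (R : comNzRingType) (P Q : prime_idealr R) : Prop :=
  {subset P <= Q} /\ ~ {subset Q <= P}.

(* [P 0 < P 1 < ... < P d]; the values of [P] beyond [d] are irrelevant. *)
Definition prime_chain (R : comNzRingType) (d : nat) : Prop :=
  exists P : nat -> prime_idealr R,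
    forall i, (i < d)%N -> prime_lt (P i) (P i.+1).

Definition krull_dim (R : comNzRingType) : natinf := natinf_sup (prime_chain R).

(* Each [s`_i] is a non-zerodivisor on R/(s_0, ..., s_{i-1}), and R/(s) <> 0. *)
Definition regular_seq (R : comNzRingType) (s : seq R) : Prop :=
  (forall i, (i < size s)%N ->
     forall x, ideal_gen (take i s) (s`_i * x) -> ideal_gen (take i s) x)
  /\ ~ ideal_gen s 1.

Definition nonunit (R : comNzRingType) (x : R) : Prop :=
  ~ exists y, y * x = 1.

(* The depth of a local ring, whose maximal ideal is the set of non-units. *)
Definition local_depth (R : comNzRingType) : natinf :=
  natinf_sup (fun d => exists s : seq R,
    [/\ size s = d, forall x, x \in s -> nonunit x & regular_seq s]).

(* The localization of a domain at a prime, as the subring of its field of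
   fractions consisting of the a/s with s outside the prime. *)
Section Localization.
Variables (A : idomainType) (P : prime_idealr A).

Definition loc_pred : {pred {fraction A}} :=
  fun f => `[< exists a s : A, s \notin P /\ f = a%:F / s%:F >].

Lemma notin_prime_neq0 (s : A) : s \notin P -> s%:F != 0 :> {fraction A}.
Proof.
by apply: contraNneq => /eqP; rewrite tofrac_eq0 => /eqP ->; exact: idealr0.
Qed.

Lemma notin_primeM (s t : A) : s \notin P -> t \notin P -> s * t \notin P.
Proof. by rewrite prime_idealrM negb_or => -> ->. Qed.

Lemma loc_subring : subring_closed loc_pred.
Proof.
split.
- apply/asboolP; exists 1, 1; split; first by rewrite idealr1.
  by rewrite tofrac1 divr1.
- move=> f g /asboolP[a [s [Ps ->]]] /asboolP[b [t [Pt ->]]].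
  apply/asboolP; exists (a * t - b * s), (s * t); split.
    exact: notin_primeM.
  have s0 := notin_prime_neq0 Ps; have t0 := notin_prime_neq0 Pt.
  by rewrite -mulNr addf_div // tofracM tofracB !tofracM mulNr.
- move=> f g /asboolP[a [s [Ps ->]]] /asboolP[b [t [Pt ->]]].
  apply/asboolP; exists (a * b), (s * t); split; first exact: notin_primeM.
  by rewrite !tofracM mulf_div.
Qed.

HB.instance Definition _ :=
  GRing.isSubringClosed.Build {fraction A} loc_pred loc_subring.

Record loc : Type := Loc { loc_val : {fraction A}; _ : loc_val \in loc_pred }.

HB.instance Definition _ := [isSub for loc_val].
HB.instance Definition _ := [Choice of loc by <:].
HB.instance Definition _ := [SubChoice_isSubComNzRing of loc by <:].

End Localization.

(* Serre's condition (S_n) *)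
Definition serre (n : nat) (A : idomainType) : Prop :=
  forall P : prime_idealr A,
    natinf_le (natinf_min (Some n) (krull_dim (loc P))) (local_depth (loc P)).

(* The total ring of fractions of a domain is its field of fractions. *)
Definition weakly_arf (A : idomainType) : Prop :=
  forall x y z : A, GRing.lreg x ->
    integralOver (@tofrac A) (y%:F / x%:F) ->
    integralOver (@tofrac A) (z%:F / x%:F) ->
    exists w : A, y%:F * z%:F / x%:F = w%:F.

Definition subfield (A : comNzRingType) (K : {pred A}) : Prop :=
  subring_closed K /\
  (forall x, x \in K -> x != 0 -> exists2 y, y \in K & y * x = 1).

Definition contains_infinite_field (A : comNzRingType) : Prop :=
  exists K : {pred A}, subfield K /\ infinite_set [set` K].

(* Main.v *)
Require Import Defs.
From mathcomp Require Import all_boot all_order all_algebra.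
From mathcomp Require Import boolp classical_sets cardinality finmap.
From mathcomp Require Import mpoly.

Set Implicit Arguments.
Unset Strict Implicit.
Unset Printing Implicit Defensive.

Import GRing.Theory.
Local Open Scope ring_scope.

(** Let [f], [g], [h] be elements of [A[X]] with [g/f] and [h/f] integral over
    [A[X]], where [A] is a weakly Arf domain with field of fractions [K].  Two
    facts force [gh/f] into [A[X]].

    First, [gh/f] lies in [K[X]], because [K[X]] is integrally closed
    ([integral_quotient_dvdp]).

    Second, its values are in [A] at all points of [A] outside the finitely many
    roots of [f]: evaluating the integral equations at [a] shows that
    [g(a)/f(a)] and [h(a)/f(a)] are integral over [A] as soon as [f(a) <> 0], so
    that [g(a)h(a)/f(a)] is in [A] by the weak Arf property of [A].
    A polynomial over [K] whose values are in [A] at more points than its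
    degree, the differences of these points being units of [A], has its
    coefficients in [A], by interpolation
    ([unit_separated_interpolation]).  An infinite field in [A] provides as many
    such points as needed, even after the roots of [f] are discarded.

    This settles one variable ([weakly_arf_poly]).  Several variables follow by
    induction, since [A[X_1..X_(n+1)]] is [A[X_1..X_n][X]] and the supply of
    points persists in [A[X_1..X_n]].  The converse holds because [A] is a
    retract of [A[X]], and the weak Arf property passes to retracts
    ([weakly_arf_retract]). *)

(** The equation of integral dependence of [y / x], cleared of denominators.
    It makes sense in any commutative ring, so it can be transported along
    arbitrary ring morphisms, such as evaluation at a point, which need not
    extend to fields of fractions. *)
Definition integral_quotient (R : comNzRingType) (x y : R) : Prop :=
  exists n (c : nat -> R), y ^+ n = \sum_(i < n) c i * y ^+ i * x ^+ (n - i).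

Lemma integral_quotient_morph (R S : comNzRingType) (phi : {rmorphism R -> S})
    (x y : R) :
  integral_quotient x y -> integral_quotient (phi x) (phi y).
Proof.
case=> n [c yn]; exists n, (phi \o c); rewrite -rmorphXn yn rmorph_sum.
by apply: eq_bigr => i _; rewrite !rmorphM !rmorphXn.
Qed.

Lemma tofrac_inj (A : idomainType) : injective (@tofrac A).
Proof. by move=> a b /eqP; rewrite tofrac_eq => /eqP. Qed.

Lemma integralOver_fracE (A : idomainType) (x y : A) : x != 0 ->
  integralOver (@tofrac A) (y%:F / x%:F) <-> integral_quotient x y.
Proof.
move=> x0; have xF0 : x%:F != 0 :> {fraction A} by rewrite tofrac_eq0.
have sizeF (p : {poly A}) : size (map_poly (@tofrac A) p) = size p.
  exact: size_map_inj_poly (@tofrac_inj A) (tofrac0 _) p.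
pose u : {fraction A} := y%:F / x%:F.
have uE n i : (i <= n)%N -> u ^+ i * x%:F ^+ n = (y ^+ i * x ^+ (n - i))%:F.
  move=> le_in; rewrite -{1}(subnKC le_in) exprD mulrA -exprMn divfK //.
  by rewrite tofracM !tofracXn.
split=> [[p /monicP p_monic /rootP]|[n [c yn]]].
  set n := (size p).-1.
  have sz_p : size p = n.+1.
    by rewrite prednK // lt0n size_poly_eq0 -lead_coef_eq0 p_monic oner_eq0.
  move=> pu0; exists n, (fun i => - p`_i).
  have : (map_poly (@tofrac A) p).[u] * x%:F ^+ n = 0 by rewrite pu0 mul0r.
  rewrite (@horner_coef_wide _ n.+1) ?sizeF ?sz_p //.
  rewrite big_ord_recr /= mulrDl mulr_suml coef_map /=.
  rewrite -/(lead_coef p) p_monic tofrac1 mul1r uE // subnn expr0 mulr1.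
  move/eqP; rewrite addr_eq0 => /eqP sumE.
  apply/eqP; rewrite -tofrac_eq -[X in X == _]opprK -sumE -sumrN rmorph_sum.
  apply/eqP; apply: eq_bigr => i _.
  by rewrite coef_map /= -mulrA uE 1?ltnW // -tofracM -tofracN mulrA !mulNr.
exists ('X^n - \poly_(i < n) c i).
  apply/monicP; rewrite lead_coefDl ?lead_coefXn // size_polyN size_polyXn.
  by rewrite ltnS size_poly.
apply/rootP; apply: (mulIf (expf_neq0 n xF0)); rewrite mul0r.
rewrite rmorphB /= map_polyXn hornerD hornerN hornerXn mulrBl uE // subnn mulr1.
rewrite (@horner_coef_wide _ n) ?sizeF ?size_poly //.
rewrite yn rmorph_sum mulr_suml; apply/eqP; rewrite subr_eq0; apply/eqP.
apply: eq_bigr => i _; rewrite coef_map coef_poly ltn_ord /= -[RHS]mulrA.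
by rewrite uE 1?ltnW // -tofracM mulrA.
Qed.

Lemma weakly_arfE (A : idomainType) :
  weakly_arf A <->
  (forall x y z : A, x != 0 -> integral_quotient x y -> integral_quotient x z ->
     exists w, y * z = w * x).
Proof.
split=> arfA x y z.
  move=> x0 xy xz; have xF0 : x%:F != 0 :> {fraction A} by rewrite tofrac_eq0.
  have [|||w /(canRL (divfK xF0)) yzE] := arfA x y z.
  - exact/lregP.
  - exact/integralOver_fracE.
  - exact/integralOver_fracE.
  by exists w; apply/eqP; rewrite -tofrac_eq !tofracM yzE.
move=> /lregP x0 /(integralOver_fracE _ x0) xy /(integralOver_fracE _ x0) xz.
have [w yzE] := arfA x y z x0 xy xz; exists w.
by rewrite -tofracM yzE tofracM mulfK // tofrac_eq0.
Qed.

(** Integral dependence goes forward along [phi]; the resulting witness comes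
    back along [psi], which fixes what came from [A]. *)
Lemma weakly_arf_retract (A B : idomainType) (phi : {rmorphism A -> B})
    (psi : {rmorphism B -> A}) :
  cancel phi psi -> weakly_arf B -> weakly_arf A.
Proof.
move=> phiK /weakly_arfE arfB; apply/weakly_arfE => x y z x0 xy xz.
have [||| w yzE] := arfB (phi x) (phi y) (phi z).
- by rewrite -(rmorph0 phi) (inj_eq (can_inj phiK)).
- exact: integral_quotient_morph.
- exact: integral_quotient_morph.
by exists (psi w); rewrite -(phiK (y * z)) rmorphM yzE rmorphM phiK.
Qed.

(** [K[X]] is integrally closed.  With [f] and [g] divided by their gcd, the
    integral equation says that [f] divides a power of [g], to which it is
    coprime; hence what remains of [f] is a unit. *)
Lemma integral_quotient_dvdp (K : fieldType) (f g : {poly K}) :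
  f != 0 -> integral_quotient f g -> f %| g.
Proof.
move=> f0 [n [c gn]]; pose d := gcdp f g.
have d0 : d != 0 by rewrite gcdp_eq0 negb_and f0.
have co_fg : coprimep (f %/ d) (g %/ d) by rewrite coprimep_div_gcd ?f0.
have fE : f = f %/ d * d by rewrite divpK ?dvdp_gcdl.
have gE : g = g %/ d * d by rewrite divpK ?dvdp_gcdr.
suff dv1 : f %/ d %| 1.
  by rewrite fE gE dvdp_mul2r // (dvdp_trans dv1) ?dvd1p.
rewrite -(Gauss_dvdpr _ (coprimep_expr n co_fg)) mulr1.
(* The integral equation is homogeneous of degree [n] in [f] and [g], so a
   factor [d ^+ n] cancels. *)
have -> : (g %/ d) ^+ n =
    \sum_(i < n) c i * (g %/ d) ^+ i * (f %/ d) ^+ (n - i).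
  apply: (mulIf (expf_neq0 n d0)); rewrite -exprMn -gE gn mulr_suml.
  apply: eq_bigr => i _.
  have -> : d ^+ n = d ^+ i * d ^+ (n - i) by rewrite -exprD subnKC 1?ltnW.
  by rewrite {1}gE {1}fE !exprMn (mulrA (c i)) mulrACA.
apply: (big_ind (fun u => f %/ d %| u)) => [|u v|i _]; first exact: dvdp0.
  exact: dvdp_add.
by rewrite dvdp_mull // dvdp_exp // subn_gt0.
Qed.

Definition unit_separated (A : comUnitRingType) (s : seq A) : bool :=
  pairwise (fun a b => b - a \is a GRing.unit) s.

(** This replaces the infinite subfield: it is all that interpolation needs, and
    any ring morphism transports it, injective or not. *)
Definition has_long_unit_separated (A : comUnitRingType) : Prop :=
  forall n, exists2 s : seq A, size s = n & unit_separated s.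

Lemma unit_separated_uniq (A : comUnitRingType) (s : seq A) :
  unit_separated s -> uniq s.
Proof.
rewrite uniq_pairwise; apply: sub_pairwise => a b /= u_ab.
by apply: contraTneq u_ab => ->; rewrite subrr unitr0.
Qed.

Lemma has_long_unit_separated_morph (A B : comUnitRingType)
    (phi : {rmorphism A -> B}) :
  has_long_unit_separated A -> has_long_unit_separated B.
Proof.
move=> sepA n; have [s sz_s sep_s] := sepA n; exists (map phi s).
  by rewrite size_map.
rewrite /unit_separated pairwise_map; apply: sub_pairwise sep_s => a b /= u_ab.
by rewrite -rmorphB rmorph_unit.
Qed.

Lemma infinite_field_unit_separated (A : idomainType) :
  contains_infinite_field A -> has_long_unit_separated A.
Proof.
case=> K [[[_ subK _] invK] infK] n.
have [s sK sz_s] := infinite_set_fset n infK.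
exists (take n s); first by rewrite size_takel.
rewrite /unit_separated.
apply: (sub_in_pairwise (P := mem s) (r := fun a b => a != b)).
- move=> a b /sK Ka /sK Kb /= ab.
  have [||v _ vE] := invK (b - a); first exact: subK.
    by rewrite subr_eq0 eq_sym.
  by apply/unitrPr; exists v; rewrite mulrC.
- by apply/allP => a /mem_take.
- by rewrite -uniq_pairwise take_uniq.
Qed.

(** Newton interpolation: after the first node [a], the polynomial
    [(P - P(a)) / (X - a)] has smaller degree, and its values at the other nodes
    [c] are again in the image of [A] because [c - a] is invertible there. *)
Lemma unit_separated_interpolation (A : comUnitRingType) (L : comNzRingType)
    (phi : {rmorphism A -> L}) (s : seq A) (P : {poly L}) :
  unit_separated s -> (size P <= size s)%N ->
  (forall a, a \in s -> exists b, P.[phi a] = phi b) ->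
  exists W : {poly A}, P = map_poly phi W.
Proof.
elim: s P => [|a s IHs] P /=.
  move=> _; rewrite leqn0 size_poly_eq0 => /eqP-> _.
  by exists 0; rewrite rmorph0.
rewrite /unit_separated /= => /andP[/allP sep_a sep_s] sz_P valP.
have [b Pa] := valP a (mem_head a s).
have /factor_theorem[Q PE] : root (P - P.[phi a]%:P) (phi a).
  by rewrite rootE !hornerE subrr.
have [||W QE] := IHs Q sep_s.
- have [->|Q0] := eqVneq Q 0; first by rewrite size_poly0.
  have : (size (P - P.[phi a]%:P)%R <= (size s).+1)%N.
    rewrite (leq_trans (size_polyD _ _)) // geq_max sz_P size_polyN.
    by rewrite (leq_trans (size_polyC_leq1 _)).
  by rewrite PE size_Mmonic ?monicXsubC // size_XsubC addn2.
- move=> c cs; have u_ca := sep_a c cs.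
  have [d Pc] : exists d, P.[phi c] = phi d by apply: valP; rewrite inE cs orbT.
  exists ((d - b) / (c - a)); rewrite rmorphM rmorphB -Pc -Pa.
  move: (congr1 (horner^~ (phi c)) PE); rewrite /= !hornerE => ->.
  by rewrite -mulrA -rmorphB -rmorphM mulrV // rmorph1 mulr1.
exists (W * ('X - a%:P) + b%:P).
rewrite rmorphD rmorphM rmorphB /= -QE map_polyX !map_polyC /= -Pa.
by rewrite -PE subrK.
Qed.

Lemma weakly_arf_poly (A : idomainType) :
  has_long_unit_separated A -> weakly_arf A -> weakly_arf {poly A}.
Proof.
move=> sepA /weakly_arfE arfA; apply/weakly_arfE => f g h f0 fg fh.
pose toK : {rmorphism {poly A} -> {poly {fraction A}}} :=
    map_poly (@tofrac A).
have toK_inj : injective toK.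
  exact: map_inj_poly (@tofrac_inj A) (tofrac0 _).
have toKf0 : toK f != 0 by rewrite -(rmorph0 toK) (inj_eq toK_inj).
have /dvdpP[P PE] : toK f %| toK (g * h).
  rewrite rmorphM dvdp_mulr //; apply: integral_quotient_dvdp => //.
  exact: integral_quotient_morph.
have [s sz_s sep_s] := sepA (size P + size f)%N.
pose t := [seq a <- s | ~~ root f a].
have [|||W WE] := @unit_separated_interpolation A _ (@tofrac A) t P.
- exact: pairwise_filter.
(* [f] has fewer than [size f] roots, so at least [size P] of the
   [size P + size f] nodes are left. *)
- have le_roots : (count (root f) s <= size f)%N.
    rewrite -size_filter ltnW // max_poly_roots ?filter_all //.
    exact/filter_uniq/unit_separated_uniq.
  rewrite -(leq_add2r (size f)) -sz_s -(count_predC (root f) s) addnC.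
  by rewrite /t size_filter leq_add.
- move=> a; rewrite mem_filter => /andP[fa0 _].
  have [|||b gha] := arfA f.[a] g.[a] h.[a].
  + exact: fa0.
  + exact: (integral_quotient_morph (horner_eval a)).
  + exact: (integral_quotient_morph (horner_eval a)).
  exists b; apply: (mulIf (_ : f.[a]%:F != 0)); first by rewrite tofrac_eq0.
  rewrite -tofracM -gha -hornerM -!horner_map -hornerM.
  exact: (congr1 (horner^~ a%:F) (esym PE)).
by exists W; apply: toK_inj; rewrite PE WE rmorphM.
Qed.

Lemma weakly_arf_mpolyS (A : idomainType) (n : nat) :
  weakly_arf {poly {mpoly A[n]}} -> weakly_arf {mpoly A[n.+1]}.
Proof.
pose unfold_last : {rmorphism {poly {mpoly A[n]}} -> {mpoly A[n.+1]}} :=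
  horner_eval 'X_ord_max \o map_poly (@mwiden n A).
apply: (@weakly_arf_retract _ _ (@muni n A) unfold_last) => p.
rewrite -[LHS]/((map_poly (@mwiden n A) (muni p)).['X_ord_max]).
rewrite muniE rmorph_sum horner_sum [RHS]mpolyE; apply: eq_bigr => m _ /=.
rewrite map_polyZ map_polyXn hornerZ hornerXn /= mwidenZ mwidenX -scalerAl.
(* It remains to reassemble an exponent vector from its last entry and the
   others. *)
rewrite mpolyXn -mpolyXD; congr (_ *: 'X_[_]); apply/mnmP => i.
rewrite mnmDE mulmnE mnm1E; case: (unliftP ord_max i) => [j ->|->].
  rewrite (negPf (neq_lift _ _)) mul0n addn0.
  have -> : lift ord_max j = widen_ord (leqnSn n) j.
    by apply: val_inj; exact: lift_max.
  by rewrite mnmwiden_widen mnmE.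
by rewrite mnmwiden_ordmax eqxx mul1n.
Qed.

Theorem theorem1p3 (A : idomainType) (hN : noetherian A) (hS2 : serre 2 A)
    (hK : contains_infinite_field A) :
  weakly_arf A <-> (forall n : nat, (1 <= n)%N -> weakly_arf {mpoly A[n]}).
Proof.
split=> [arfA n _|arf_mpoly]; last first.
  apply: (@weakly_arf_retract _ _ (@mpolyC 1 A) (@mcoeff 1 A 0%MM)) => [a|].
    by rewrite /= mcoeffC eqxx mulr1.
  exact: arf_mpoly.
have sepA := infinite_field_unit_separated hK.
elim: n => [|n IHn].
  apply: (@weakly_arf_retract _ A (@mcoeff 0 A 0%MM) (@mpolyC 0 A)) => // p.
  apply/mpolyP => m; have -> : m = 0%MM by apply/mnmP => -[].
  by rewrite /= mcoeffC eqxx mulr1.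
apply/weakly_arf_mpolyS/weakly_arf_poly => //.
exact: (has_long_unit_separated_morph (@mpolyC n A)).
Qed.
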